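(* Let $A>0$, $s>0$. Then there is $c>0$ such that for any $n\geq 1$, any independent sequence $X_1,\dots,X_n$ of real random variables with $$E(X_i)=0,\quad E(X_i^4)\leq A,\quad E(X_i\mathbf{1}_{X_i>0})\geq s,\qquad i=1,\dots,n,$$ and any $u\geq 0$, $$P_u(\tau>n)\leq\frac{c(u+1)}{\sqrt{n}}.$$
   Context: Under $P_u$ the walk is $S_0=u$, $S_k=u+X_1+\dots+X_k$, and $\tau=\min\{k\geq 1: S_k<0\}$ (so $\{\tau>n\}=\{S_k\geq 0,\ k=1,\dots,n\}$). *)

(* Defs.v *)
From HB Require Import structures.
From mathcomp Require Import all_boot all_order all_algebra.
From mathcomp Require Import all_classical all_reals all_analysis.

Set Implicit Arguments.
Unset Strict Implicit.
Unset Printing Implicit Defensive.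

Import Order.TTheory GRing.Theory Num.Theory.
Local Open Scope classical_set_scope.
Local Open Scope ring_scope.

Definition mutual_independence d (T : measurableType d) (R : realType)
    (P : probability T R) (I : finType) (X : I -> {RV P >-> R}) : Prop :=
  forall (J : {set I}) (B : I -> set R),
    (forall i, i \in J -> measurable (B i)) ->
    P (\bigcap_(i in [set` J]) (X i @^-1` B i)) =
    (\prod_(i in J) P (X i @^-1` B i))%E.

(* The increments X_1, ..., X_n are [X 0], ..., [X (n-1)], so that
   S_k = u + X_1 + ... + X_k for k <= n. *)
Definition walk (T : Type) (R : realType) (n : nat) (X : 'I_n -> T -> R)
    (u : R) (k : nat) (w : T) : R :=
  u + \sum_(i < n | (i < k)%N) X i w.

(* The minimum of a set of positive integers, as an infimum in \bar R: it is
   attained when the set is nonempty, and is +oo when the walk does not enter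
   the negative half-line up to time n. *)
Definition tau (T : Type) (R : realType) (n : nat) (X : 'I_n -> T -> R)
    (u : R) (w : T) : \bar R :=
  ereal_inf [set k%:R%:E | k in
    [set k : nat | (1 <= k <= n)%N /\ walk X u k w < 0]].

Lemma tau_gtE (T : Type) (R : realType) (n : nat) (X : 'I_n -> T -> R)
    (u : R) :
  [set w | (n%:R%:E < tau X u w)%E] =
  [set w | forall k, (1 <= k <= n)%N -> 0 <= walk X u k w].
Proof.
apply/seteqP; split => w /= H.
  move=> k kn; rewrite leNgt; apply/negP => Sk.
  have : (tau X u w <= k%:R%:E)%E by apply: ereal_inf_lbound; exists k.
  move=> /(lt_le_trans H); rewrite lte_fin ltr_nat ltnNge.
  by case/andP: kn => _ ->.
suff -> : tau X u w = +oo%E by rewrite ltry.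
rewrite /tau (_ : [set _ | _ in _] = set0) ?ereal_inf0//.
apply/seteqP; split => // x [k [kn Sk] _].
by have := H k kn; rewrite leNgt Sk.
Qed.

(* Main.v *)
Require Import Defs.
From HB Require Import structures.
From mathcomp Require Import all_boot all_order all_algebra.
From mathcomp Require Import all_classical all_reals all_analysis measurable_realfun.
From mathcomp Require Import ring lra.

Set Implicit Arguments.
Unset Strict Implicit.
Unset Printing Implicit Defensive.

Import Order.TTheory GRing.Theory Num.Theory.
Local Open Scope classical_set_scope.
Local Open Scope ring_scope.

(** The proof is a single supermartingale estimate. Suppose that a function F
satisfies 0 <= F (x) <= C (x + 1) / sqrt n for x >= 0, is at least 1 above a
level L of order sqrt n, and loses at least 1 / n in mean at each step that the walk makes from a point of [0, L], where F counts as 0 as soon as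
the walk is negative. Then min (1, F (S_k) + k / n), killed at time tau, is a
supermartingale; it equals 1 at time n on the event tau > n, so that
P (tau > n) <= F (u).

Up to the factor 3 / L, the function F is a sum of three terms ([lyapunov]).
- sqrt L sqrt (L + x) - L is of the order of x up to the scale L and is strictly
  concave there, with second derivative of order - 1 / L. The variance of a step
  is bounded below, so the step loses a constant over L in mean, which is the
  required 1 / n after rescaling. Killing this term costs the mean overshoot
  below 0, which is O (x^-3) because of the fourth moment.
- sqrt x loses a constant times x^(-3/2) in mean, which pays for the overshoot
  once x exceeds a constant M.
- A bounded function, constant up to an exponentially decaying term, loses at
  least a fixed amount per step on [0, M], because a step z <= - s / 4 has
  probability bounded below ([wall]). A large multiple of it pays for everything near 0.

Only three features of a step enter: mean zero, fourth moment at most A, and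
mean positive part at least s. Every drift estimate is therefore reduced to
bounding z |-> F (x + z) by a combination of 1, z, z^4 and max (z, 0)
([moment_bound]). Such bounds can be added and scaled, and are integrated once
([integral_le_moment_bound]). The passage from one step to the walk uses that
the walk stopped at tau is a function of the past and that the past is
independent of the next increment ([past_independent], [stopped_step_le]). *)

(** * One-step bounds from three moments *)

Lemma eq_ler (R : numDomainType) (x y : R) : x = y -> x <= y.
Proof. by move->. Qed.

Section moment_bound.
Variables (R : realType) (A s : R).
Hypothesis hs : 0 < s.
Implicit Types (f g : R -> R) (a b x y z : R).

(** The constant term is written so that [b] is the resulting bound for the
mean of [f] at a random variable with mean 0, fourth moment at most [A] and mean
positive part at least [s]. *)
Definition moment_bound f b := exists a1 a4 a5, [/\ 0 <= a4, 0 <= a5 &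
  forall z, f z <= b - a4 * A + a5 * s + a1 * z + a4 * z ^+ 4 - a5 * Num.max z 0].

Lemma moment_bound_le f g a b : (forall z, f z <= g z) -> a <= b ->
  moment_bound g a -> moment_bound f b.
Proof.
move=> fg ab [a1 [a4 [a5 [h4 h5 h]]]]; exists a1, a4, a5; split=> // z.
by have := h z; have := fg z; lra.
Qed.

Lemma moment_boundD f g a b : moment_bound f a -> moment_bound g b ->
  moment_bound (fun z => f z + g z) (a + b).
Proof.
move=> [a1 [a4 [a5 [h4 h5 h]]]] [b1 [b4 [b5 [k4 k5 k]]]].
exists (a1 + b1), (a4 + b4), (a5 + b5); split; [lra|lra|move=> z].
by have := h z; have := k z; lra.
Qed.

Lemma moment_boundZ f a b : 0 <= a -> moment_bound f b ->
  moment_bound (fun z => a * f z) (a * b).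
Proof.
move=> a0 [a1 [a4 [a5 [h4 h5 h]]]].
exists (a * a1), (a * a4), (a * a5); split; [exact: mulr_ge0..|move=> z].
by have := ler_wpM2l a0 (h z); lra.
Qed.

Lemma moment_bound_cst a : moment_bound (fun=> a) a.
Proof. by exists 0, 0, 0; split=> // z; lra. Qed.

Lemma moment_bound_pow4 a : 0 <= a -> moment_bound (fun z => a * z ^+ 4) (a * A).
Proof. by move=> a0; exists 0, a, 0; split=> // z; lra. Qed.

Lemma norm_le_1Dpow4 z : `|z| <= 1 + z ^+ 4.
Proof.
have h : forall t : R, t <= 1 + t ^+ 4.
  move=> t; rewrite (_ : t ^+ 4 = t ^+ 2 * t ^+ 2); last by ring.
  have := sqr_ge0 (t ^+ 2 - 1/2); have := sqr_ge0 (t - 1/2); lra.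
have [_|_] := ger0P z; first exact: h.
by have := h (- z); rewrite (_ : (- z) ^+ 4 = z ^+ 4); last ring.
Qed.

Lemma sqrt_le (a b : R) : 0 <= b -> a <= b ^+ 2 -> Num.sqrt a <= b.
Proof.
by move=> b0 ab; rewrite -(ger0_norm b0) -sqrtr_sqr ler_sqrt// sqr_ge0.
Qed.

(** The Taylor expansion of the square root, weakened in its quadratic term so
that a quartic term absorbs the remainder on the whole line, including the
region where the truncated square root vanishes. *)
Lemma sqrt1D_le_quartic z : Num.sqrt (1 + z) <= 1 + z / 2 - z ^+ 2 / 16 + z ^+ 4.
Proof.
have [z1|z1] := leP 0 (1 + z); last first.
  rewrite ler0_sqrtr; last lra.
  rewrite (_ : z ^+ 4 = z ^+ 2 * z ^+ 2); last by ring.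
  have : 1 < z ^+ 2 by nra.
  nra.
set y := Num.sqrt _.
have y0 : 0 <= y by exact: sqrtr_ge0.
have yE : y ^+ 2 = 1 + z by rewrite sqr_sqrtr.
have -> : z = y ^+ 2 - 1 by lra.
(* In terms of y, the difference of the two sides is the expression below times
   (y - 1) ^+ 2. *)
suff : 0 <= 1 / 2 - (y + 1) ^+ 2 / 16 + (y - 1) ^+ 2 * (y + 1) ^+ 4.
  move=> h; have := mulr_ge0 (sqr_ge0 (y - 1)) h; lra.
have : 0 <= (y - 1) ^+ 2 * (y + 1) ^+ 4.
  by apply: mulr_ge0; [exact: sqr_ge0|apply: exprn_ge0; lra].
have [y2|y2] := leP y (9/5); first by nra.
have : (y - 1) ^+ 2 >= 1/2 by nra.
have : (y + 1) ^+ 2 >= 1 by nra.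
rewrite (_ : (y + 1) ^+ 4 = (y + 1) ^+ 2 * (y + 1) ^+ 2); last by ring.
move: ((y + 1) ^+ 2) ((y - 1) ^+ 2) => p q p1 q1 _; nra.
Qed.

Lemma sqrtD_le_quartic y z : 0 < y -> Num.sqrt (y + z) <=
  Num.sqrt y * (1 + z / (2 * y) - z ^+ 2 / (16 * y ^+ 2) + z ^+ 4 / y ^+ 4).
Proof.
move=> y0; have -> : y + z = y * (1 + z / y) by field; lra.
rewrite sqrtrM; last lra.
rewrite ler_pM2l ?sqrtr_gt0//.
apply: (le_trans (sqrt1D_le_quartic _)); apply: eq_ler; field; lra.
Qed.

(** The variance is controlled from below through the mean positive part:
z^2 >= 2 s max (z, 0) - s^2, and the right-hand side has mean at least s^2. *)
Lemma moment_bound_sqrtD y : 0 < y -> moment_bound (fun z => Num.sqrt (y + z))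
  (Num.sqrt y * (1 - s ^+ 2 / (16 * y ^+ 2) + A / y ^+ 4)).
Proof.
move=> y0; have sy0 := sqrtr_ge0 y.
have y2 : 0 <= y ^- 2 by rewrite invr_ge0 exprn_ge0// ltW.
have y4 : 0 <= y ^- 4 by rewrite invr_ge0 exprn_ge0// ltW.
exists (Num.sqrt y / (2 * y)), (Num.sqrt y / y ^+ 4),
  (Num.sqrt y * s / (8 * y ^+ 2)).
split=> [||z]; first exact: mulr_ge0.
  by rewrite !mulr_ge0 ?(ltW hs)// invfM mulr_ge0.
have hz : 2 * s * Num.max z 0 - s ^+ 2 <= z ^+ 2.
  have := sqr_ge0 s; have := sqr_ge0 (z - s); have := sqr_ge0 z.
  by case: (leP z 0) => _; lra.
apply: (le_trans (sqrtD_le_quartic _ y0)).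
have {}hz := ler_wpM2l (mulr_ge0 (mulr_ge0 sy0 y2) (_ : 0 <= 16^-1)) hz.
have {}hz := hz ltac:(lra).
rewrite -subr_ge0; rewrite -subr_ge0 in hz; apply: le_trans hz _.
apply: eq_ler; field; lra.
Qed.

(** For large [y] the fourth-moment error uses up at most half of the gain that
comes from concavity. *)
Lemma moment_bound_sqrtD_drift y : 0 < y -> 32 * A / s ^+ 2 <= y ^+ 2 ->
  moment_bound (fun z => Num.sqrt (y + z))
    (Num.sqrt y - Num.sqrt y * s ^+ 2 / (32 * y ^+ 2)).
Proof.
move=> y0 hy; apply: moment_bound_le (moment_bound_sqrtD y0) => //.
have sy0 := sqrtr_ge0 y.
have y4 : 0 <= y ^- 4 by rewrite invr_ge0 exprn_ge0// ltW.
have s2 : 0 < s ^+ 2 by exact: exprn_gt0.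
move: hy; rewrite ler_pdivrMr// => hy.
rewrite -subr_ge0 in hy.
have := mulr_ge0 (mulr_ge0 sy0 y4) hy.
move=> h; rewrite -subr_ge0.
rewrite (_ : _ - _ =
  Num.sqrt y * y ^- 4 * (y ^+ 2 * s ^+ 2 - 32 * A) / 32); last by field; lra.
by rewrite divr_ge0.
Qed.

End moment_bound.

(** * Killed functions and their overshoot *)

Section killed.
Variable R : realType.
Implicit Types (f : R -> R) (L x z : R).

Definition killed f x : R := if 0 <= x then f x else 0.

(** A function comparable to x on [0, L], whose concavity on the scale L is of
order 1 / L. *)
Definition sqrt_profile L x : R := Num.sqrt L * Num.sqrt (L + x) - L.

Lemma sqrt_profile_le L x : 0 <= L -> 0 <= x -> sqrt_profile L x <= x.
Proof.
move=> L0 x0; rewrite /sqrt_profile lerBlDl -sqrtrM//.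
by apply: sqrt_le; [lra|nra].
Qed.

Lemma sqrt_profile_ge0 L x : 0 <= L -> 0 <= x -> 0 <= sqrt_profile L x.
Proof.
move=> L0 x0; rewrite /sqrt_profile subr_ge0 -sqrtrM// -{1}(sqr_sqrtr L0) expr2.
by rewrite -sqrtrM// ler_sqrt; nra.
Qed.

Lemma sqrt_profile_ge_third L x : 0 <= L -> L <= x -> L / 3 <= sqrt_profile L x.
Proof.
move=> L0 x0; rewrite /sqrt_profile lerBrDr -sqrtrM//.
rewrite -(@ger0_norm _ (L / 3 + L)); last lra.
by rewrite -sqrtr_sqr ler_sqrt; nra.
Qed.

Lemma sqrt_profile_ge_neg L x : 0 <= L -> x < 0 -> x <= sqrt_profile L x.
Proof.
move=> L0 x0; rewrite /sqrt_profile lerBrDr -sqrtrM//.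
have [Lx|Lx] := leP 0 (x + L); last first.
  by apply: (le_trans (ltW Lx)); exact: sqrtr_ge0.
by rewrite -(ger0_norm Lx) -sqrtr_sqr ler_sqrt; nra.
Qed.

(** The profile lies above the identity on the negative half-line, so killing it
costs at most the overshoot. *)
Lemma killed_sqrt_profile_le L x : 0 <= L ->
  killed (sqrt_profile L) x <= sqrt_profile L x + Num.max (- x) 0.
Proof.
move=> L0; rewrite /killed; case: (leP 0 x) => x0.
  by rewrite lerDl le_max lexx orbT.
have := sqrt_profile_ge_neg L0 x0; case: (leP (- x) 0); lra.
Qed.

(** A step from [x] reaches the negative half-line only if it exceeds [x] in
absolute value, where the fourth power dominates the overshoot. *)
Lemma ruin_le_quartic x z : 0 < x -> Num.max (- (x + z)) 0 <= z ^+ 4 / x ^+ 3.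
Proof.
move=> x0; rewrite ler_pdivlMr ?exprn_gt0//.
have z4 : 0 <= z ^+ 4 by exact: exprn_even_ge0.
case: (leP (- (x + z)) 0) => xz; first by rewrite mul0r.
rewrite (_ : z ^+ 4 = (- z) ^+ 3 * - z); last by ring.
have h : x ^+ 3 <= (- z) ^+ 3 by rewrite lerXn2r ?nnegrE; lra.
have x3 : 0 <= x ^+ 3 by rewrite exprn_ge0// ltW.
nra.
Qed.

End killed.

(** * Drift of the two square-root terms *)

Section step.
Variables (R : realType) (A s : R).
Hypothesis hs : 0 < s.
Implicit Types L x z : R.

Lemma moment_bound_sqrt_profile L x :
  0 < L -> 32 * A / s ^+ 2 <= L ^+ 2 -> 0 <= x <= L ->
  moment_bound A s (fun z => sqrt_profile L (x + z))
    (sqrt_profile L x - s ^+ 2 / (128 * L)).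
Proof.
move=> L0 hL /andP[x0 xL].
have hLx : 32 * A / s ^+ 2 <= (L + x) ^+ 2 by apply: (le_trans hL); nra.
have Lx0 : 0 < L + x by lra.
have := moment_boundZ (sqrtr_ge0 L) (moment_bound_sqrtD_drift hs Lx0 hLx).
move=> /moment_boundD/(_ (moment_bound_cst A s (- L))).
apply: moment_bound_le => [z|]; first by rewrite /sqrt_profile addrA.
rewrite /sqrt_profile.
have -> : Num.sqrt L * (Num.sqrt (L + x) - Num.sqrt (L + x) * s ^+ 2 /
    (32 * (L + x) ^+ 2)) - L = Num.sqrt L * Num.sqrt (L + x) - L -
    Num.sqrt L * Num.sqrt (L + x) / (L + x) ^+ 2 * (s ^+ 2 / 32) by field; lra.
rewrite lerD2l lerN2.
have -> : s ^+ 2 / (128 * L) = (4 * L)^-1 * (s ^+ 2 / 32) by field; lra.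
rewrite ler_wpM2r ?divr_ge0 ?sqr_ge0//.
rewrite ler_pdivlMr ?exprn_gt0// mulrC ler_pdivrMr; last lra.
have h : L <= Num.sqrt L * Num.sqrt (L + x).
  by have := sqrt_profile_ge0 (ltW L0) x0; rewrite /sqrt_profile; lra.
nra.
Qed.

Lemma moment_bound_killed_sqrt_profile_far L x :
  0 < L -> 32 * A / s ^+ 2 <= L ^+ 2 -> 0 < x <= L ->
  moment_bound A s (fun z => killed (sqrt_profile L) (x + z))
    (sqrt_profile L x - s ^+ 2 / (128 * L) + A / x ^+ 3).
Proof.
move=> L0 hL /andP[x0 xL].
have x3 : 0 <= (x ^+ 3)^-1 by rewrite invr_ge0 exprn_ge0// ltW.
have hx : 0 <= x <= L by rewrite ltW.
have := moment_boundD (moment_bound_sqrt_profile L0 hL hx) (moment_bound_pow4 A s x3).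
apply: moment_bound_le => [z|]; last by rewrite [A / _]mulrC.
apply: (le_trans (killed_sqrt_profile_le _ (ltW L0))).
by rewrite lerD2l mulrC ruin_le_quartic.
Qed.

(** Near 0 the overshoot estimate degenerates; the overshoot is instead bounded
by the size of the step. *)
Lemma moment_bound_killed_sqrt_profile_near L x :
  0 < L -> 32 * A / s ^+ 2 <= L ^+ 2 -> 0 <= x <= L ->
  moment_bound A s (fun z => killed (sqrt_profile L) (x + z))
    (sqrt_profile L x - s ^+ 2 / (128 * L) + (1 + A)).
Proof.
move=> L0 hL /andP[x0 xL].
have hx : 0 <= x <= L by rewrite x0.
have := moment_boundD (moment_bound_sqrt_profile L0 hL hx)
  (moment_boundD (moment_bound_cst A s 1) (moment_bound_pow4 A s ler01)).
rewrite mul1r; apply: moment_bound_le => // z.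
apply: (le_trans (killed_sqrt_profile_le _ (ltW L0))).
rewrite lerD2l mul1r; apply: le_trans (norm_le_1Dpow4 z).
by rewrite ge_max normr_ge0 andbT; have := ler_norm (- z); rewrite normrN; lra.
Qed.

(** The gain is a constant times x^(-3/2), which exceeds A / x^3, the bound for
the overshoot of the profile, when [x] is large. *)
Lemma moment_bound_sqrt_far x : 1 <= x -> 32 * A <= x * s ^+ 2 ->
  moment_bound A s (fun z => Num.sqrt (x + z)) (Num.sqrt x - A / x ^+ 3).
Proof.
move=> x1 Ax; have x0 : 0 < x by lra.
have s2 : 0 < s ^+ 2 by exact: exprn_gt0.
have hx : 32 * A / s ^+ 2 <= x ^+ 2.
  by rewrite ler_pdivrMr//; apply: (le_trans Ax); rewrite ler_pM2r// ler_eXnr.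
apply: moment_bound_le (moment_bound_sqrtD_drift hs x0 hx) => //.
rewrite lerD2l lerN2.
have sx : 1 <= Num.sqrt x by rewrite -[leLHS]sqrtr1 ler_sqrt // ltW.
rewrite (_ : _ * s ^+ 2 / _ = Num.sqrt x * (x * s ^+ 2) / 32 / x ^+ 3); last first.
  by field; lra.
rewrite ler_pM2r ?invr_gt0 ?exprn_gt0// ler_pdivlMr// mulrC.
by apply: (le_trans Ax); rewrite ler_peMl// mulr_ge0 ?(ltW s2)// ltW.
Qed.

Lemma moment_bound_sqrt_near x : 0 <= x ->
  moment_bound A s (fun z => Num.sqrt (x + z)) (Num.sqrt x + (2 + x + A)).
Proof.
move=> x0.
have := moment_boundD (moment_bound_cst A s (2 + x)) (moment_bound_pow4 A s ler01).
rewrite mul1r; apply: moment_bound_le => [z|]; last by rewrite lerDr sqrtr_ge0.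
have h := norm_le_1Dpow4 z; have hz := ler_norm z; have z0 := normr_ge0 z.
by apply: sqrt_le; nra.
Qed.

End step.

(** * The wall: a bounded function with a drift near the origin *)

Section wall.
Variables (R : realType) (A s N lam : R).
Hypotheses (hs : 0 < s) (N1 : 1 <= N) (AN : 4 * A <= N * s).
Hypotheses (lam0 : 0 <= lam) (NB : 4 * N <= expR (lam * (s / 4)) * s).
Implicit Types x z : R.

(** With B = expR (lam * (s / 4)) for the height, a step [z <= - (s / 4)] from
[x >= 0] brings the killed wall from B - E to at most B - B * E, where
E = expR (- (lam * x)). This holds also when the walk dies, because E <= 1. *)
Definition wall x : R := expR (lam * (s / 4)) - expR (- (lam * x)).

Let wall_height_ge1 : 1 <= expR (lam * (s / 4)).
Proof. by rewrite -expR0 ler_expR mulr_ge0// divr_ge0// ltW. Qed.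

Lemma wall_ge0 x : 0 <= x -> 0 <= wall x.
Proof.
move=> x0; rewrite subr_ge0; apply: le_trans wall_height_ge1.
by rewrite -expR0 ler_expR oppr_le0 mulr_ge0.
Qed.

Lemma wall_le x : wall x <= expR (lam * (s / 4)).
Proof. by rewrite gerBl expR_ge0. Qed.

(** A lower bound for the indicator of [z <= - (s / 4)], made of functions whose
means are controlled. Its mean is positive because the mean negative part is at
least s. *)
Definition jump_minorant z :=
  (Num.max z 0 - z - s / 4 - z ^+ 4 / N ^+ 3) / N.

Lemma jump_minorant_le1 z : jump_minorant z <= 1.
Proof.
have N0 : 0 < N by exact: lt_le_trans N1.
rewrite /jump_minorant ler_pdivrMr// mul1r.
case: (leP z 0) => z0; last first.
  have : 0 <= z ^+ 4 / N ^+ 3 by rewrite divr_ge0 ?exprn_ge0// ltW.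
  by move: hs N0; lra.
have := ruin_le_quartic z N0.
by move: hs; case: (leP (- (N + z)) 0); lra.
Qed.

Lemma jump_minorant_le0 z : - (s / 4) < z -> jump_minorant z <= 0.
Proof.
have N0 : 0 < N by exact: lt_le_trans N1.
move=> hz; rewrite /jump_minorant pmulr_lle0 ?invr_gt0//.
have : 0 <= z ^+ 4 / N ^+ 3.
  by apply: divr_ge0; [exact: exprn_even_ge0|apply: exprn_ge0; exact: ltW].
by move: hs hz; case: (leP z 0); lra.
Qed.

Lemma killed_wall_le x z : 0 <= x -> killed wall (x + z) <=
  expR (lam * (s / 4)) * (1 - expR (- (lam * x)) * jump_minorant z).
Proof.
move=> x0; set E := expR (- _); set B := expR _.
have E0 : 0 < E := expR_gt0 _.
have E1 : E <= 1 by rewrite -expR0 ler_expR oppr_le0 mulr_ge0.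
have B0 : 0 < B := expR_gt0 _.
have [hz|hz] := ltP (- (s / 4)) z.
  have hq : B <= B * (1 - E * jump_minorant z).
    rewrite ler_pMr// lerDl oppr_ge0 pmulr_rle0//; exact: jump_minorant_le0.
  apply: le_trans hq; rewrite /killed; case: (leP 0 (x + z)) => _; last exact: ltW.
  exact: wall_le.
have h : B * (1 - E) <= B * (1 - E * jump_minorant z).
  by rewrite ler_pM2l// lerD2l lerN2 ler_piMr ?jump_minorant_le1// ltW.
apply: le_trans h; rewrite /killed; case: (leP 0 (x + z)) => xz; last first.
  by rewrite mulr_ge0 ?(ltW B0)// subr_ge0.
rewrite /wall mulrBr mulr1 lerD2l lerN2 mulrDr opprD expRD -/E mulrC.
rewrite ler_wpM2l ?(ltW E0)// ler_expR -mulrN ler_wpM2l//; move: hz; lra.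
Qed.

Lemma moment_bound_wall x : 0 <= x ->
  moment_bound A s (fun z => killed wall (x + z)) (wall x - expR (- (lam * x))).
Proof.
move=> x0; pose E := expR (- (lam * x)); pose B := expR (lam * (s / 4)).
have E0 : 0 < E := expR_gt0 _.
have B0 : 0 < B := expR_gt0 _.
have N0 : 0 < N by exact: lt_le_trans N1.
pose b := B * E / N.
have b0 : 0 <= b by rewrite divr_ge0 ?mulr_ge0// ltW.
have AN3 : A / N ^+ 3 <= s / 4.
  rewrite ler_pdivrMr ?exprn_gt0//.
  have : N <= N ^+ 3 by rewrite -[leLHS]expr1 ler_weXn2l.
  by move: hs AN; nra.
exists b, (b / N ^+ 3), b; split => // [|z].
  by rewrite divr_ge0// exprn_ge0// ltW.
apply: (le_trans (killed_wall_le z x0)).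
have hE : 2 * E <= b * (s / 2).
  rewrite /b mulrAC ler_pdivlMr//.
  have : 4 * N <= B * s := NB.
  by move: E0; nra.
have hb := ler_wpM2l b0 AN3.
have -> : expR (lam * (s / 4)) * (1 - expR (- (lam * x)) * jump_minorant z) =
    B - b * (Num.max z 0 - z - s / 4 - z ^+ 4 / N ^+ 3).
  by rewrite /b /jump_minorant -/B -/E; field; rewrite gt_eqF.
have -> : b / N ^+ 3 * A = b * (A / N ^+ 3) by ring.
have -> : b / N ^+ 3 * z ^+ 4 = b * (z ^+ 4 / N ^+ 3) by ring.
rewrite /wall -/B -/E; lra.
Qed.

End wall.

(** * The Lyapunov function *)

Section lyapunov.
Variables (R : realType) (A s N lam M K : R).
Hypotheses (hs : 0 < s) (N1 : 1 <= N) (AN : 4 * A <= N * s).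
Hypotheses (lam0 : 0 <= lam) (NB : 4 * N <= expR (lam * (s / 4)) * s).
Hypotheses (M1 : 1 <= M) (MA : 32 * A <= M * s ^+ 2).
Hypotheses (K0 : 0 <= K) (KM : 4 + M + 2 * A <= K * expR (- (lam * M))).
Implicit Types L x z : R.

Definition lyapunov L x : R := sqrt_profile L x + Num.sqrt x + K * wall s lam x.

Lemma measurable_lyapunov L : measurable_fun setT (lyapunov L).
Proof.
have msqrt : measurable_fun setT (@Num.sqrt R).
  by apply: continuous_measurable_fun => x; exact: sqrt_continuous.
apply: measurable_funD; first apply: measurable_funD => //.
  rewrite /sqrt_profile; apply: measurable_funB => //; apply: measurable_funM => //.
  by apply: measurableT_comp => //; exact: measurable_funD.
apply: measurable_funM => //; rewrite /wall; apply: measurable_funB => //.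
apply: measurableT_comp => //; apply: measurableT_comp => //.
Qed.

Lemma lyapunov_ge0 L x : 0 <= L -> 0 <= x -> 0 <= lyapunov L x.
Proof.
move=> L0 x0.
have h1 := sqrt_profile_ge0 L0 x0; have h2 := sqrtr_ge0 x.
by rewrite /lyapunov addr_ge0 ?(addr_ge0 h1 h2)// mulr_ge0//; exact: wall_ge0.
Qed.

Lemma lyapunov_ge_third L x : 0 <= L -> L <= x -> L / 3 <= lyapunov L x.
Proof.
move=> L0 Lx; apply: (le_trans (sqrt_profile_ge_third L0 Lx)).
rewrite /lyapunov -addrA lerDl addr_ge0 ?sqrtr_ge0// mulr_ge0//.
by apply: wall_ge0 => //; exact: le_trans Lx.
Qed.

Lemma lyapunov_le L x : 0 <= L -> 0 <= x ->
  lyapunov L x <= (2 + K * expR (lam * (s / 4))) * (x + 1).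
Proof.
move=> L0 x0.
have h1 := sqrt_profile_le L0 x0.
have h2 : Num.sqrt x <= x + 1 by apply: sqrt_le; nra.
have h3 := ler_wpM2l K0 (wall_le s lam x).
have : 0 <= K * expR (lam * (s / 4)) * x by rewrite !mulr_ge0// expR_ge0.
by rewrite /lyapunov; lra.
Qed.

(** Beyond [M] the square root pays for the overshoot of the profile; below [M]
every loss is bounded and the wall pays for it. The drift of the profile is left
over in both cases. *)
Lemma moment_bound_lyapunov L x :
  0 < L -> 32 * A / s ^+ 2 <= L ^+ 2 -> 0 <= x <= L ->
  moment_bound A s (fun z => killed (lyapunov L) (x + z))
    (lyapunov L x - s ^+ 2 / (128 * L)).
Proof.
move=> L0 hL /andP[x0 xL].
have kE y : killed (lyapunov L) y <=
    killed (sqrt_profile L) y + Num.sqrt y + K * killed (wall s lam) y.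
  rewrite /killed; case: (leP 0 y) => y0 //.
  by rewrite mulr0 addr0 add0r sqrtr_ge0.
have hW := moment_boundZ K0 (moment_bound_wall hs N1 AN lam0 NB x0).
have E0 := expR_ge0 (- (lam * x)).
have [Mx|xM] := leP M x.
  have x1 : 1 <= x := le_trans M1 Mx.
  have hx : 0 < x <= L by rewrite xL andbT (lt_le_trans ltr01 x1).
  have Ax : 32 * A <= x * s ^+ 2.
    by apply: (le_trans MA); rewrite ler_wpM2r// sqr_ge0.
  have := moment_boundD (moment_boundD
    (moment_bound_killed_sqrt_profile_far hs L0 hL hx)
    (moment_bound_sqrt_far hs x1 Ax)) hW.
  apply: moment_bound_le => // ; rewrite /lyapunov.
  have : 0 <= K * expR (- (lam * x)) by exact: mulr_ge0.
  lra.
have hx : 0 <= x <= L by rewrite x0.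
have := moment_boundD (moment_boundD
  (moment_bound_killed_sqrt_profile_near hs L0 hL hx)
  (moment_bound_sqrt_near A s x0)) hW.
apply: moment_bound_le => // ; rewrite /lyapunov.
have : 4 + M + 2 * A <= K * expR (- (lam * x)).
  apply: (le_trans KM); rewrite ler_wpM2l// ler_expR lerN2 ler_wpM2l//; exact: ltW.
lra.
Qed.

End lyapunov.

Lemma exists_lyapunov (R : realType) (A s : R) : 0 < A -> 0 < s ->
  exists2 C : R, 0 < C & forall L, 0 < L -> 32 * A / s ^+ 2 <= L ^+ 2 ->
  exists F : R -> R, measurable_fun setT F /\
    [/\ forall x, 0 <= x -> 0 <= F x <= C * (x + 1),
      forall x, L <= x -> L / 3 <= F x &
      forall x, 0 <= x <= L ->
        moment_bound A s (fun z => killed F (x + z)) (F x - s ^+ 2 / (128 * L))].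
Proof.
move=> hA hs; have s2 : 0 < s ^+ 2 by exact: exprn_gt0.
(* lam makes the wall high enough through expR y >= 1 + y; K cancels the decay of
   the exponential on [0, M]. *)
pose N := 1 + 4 * A / s; pose lam := 16 * N / s ^+ 2.
pose M := 1 + 32 * A / s ^+ 2; pose K := (4 + M + 2 * A) * expR (lam * M).
have N1 : 1 <= N by rewrite lerDl divr_ge0 ?(ltW hs)// mulr_ge0// ltW.
have AN : 4 * A <= N * s.
  by rewrite (_ : N * s = s + 4 * A) ?lerDr ?(ltW hs)// /N; field; rewrite gt_eqF.
have lam0 : 0 <= lam.
  by rewrite divr_ge0 ?(ltW s2)// mulr_ge0// (le_trans ler01).
have NB : 4 * N <= expR (lam * (s / 4)) * s.
  rewrite -ler_pdivrMr//; apply: le_trans (expR_ge1Dx _).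
  rewrite (_ : lam * (s / 4) = 4 * N / s) ?lerDr//.
  by rewrite /lam; field; rewrite gt_eqF.
have M1 : 1 <= M by rewrite lerDl divr_ge0 ?(ltW s2)// mulr_ge0// ltW.
have MA : 32 * A <= M * s ^+ 2.
  rewrite (_ : M * s ^+ 2 = s ^+ 2 + 32 * A) ?lerDr ?(ltW s2)// /M; field.
  by rewrite gt_eqF.
have K0 : 0 <= K by rewrite mulr_ge0 ?expR_ge0//; lra.
have KM : 4 + M + 2 * A <= K * expR (- (lam * M)).
  by rewrite /K -mulrA -expRD subrr expR0 mulr1.
exists (2 + K * expR (lam * (s / 4))).
  by rewrite ltr_pwDl// mulr_ge0// expR_ge0.
move=> L L0 hL; exists (lyapunov s lam K L); split.
  exact: measurable_lyapunov.
have L0' := ltW L0.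
split=> [x x0|x Lx|x hx].
- by rewrite lyapunov_ge0 ?lyapunov_le.
- exact: lyapunov_ge_third.
- exact: (@moment_bound_lyapunov _ A s N lam M K).
Qed.

(** * Independence of the past and the next increment *)

Section independent_pair.
Context d d1 d2 (T : measurableType d) (T1 : measurableType d1)
  (T2 : measurableType d2) (R : realType) (P : probability T R).
Variables (U : {RV P >-> T1}) (V : {RV P >-> T2}).
Hypothesis UV : forall B C, measurable B -> measurable C ->
  P (U @^-1` B `&` V @^-1` C) = (P (U @^-1` B) * P (V @^-1` C))%E.

(** The joint law of an independent pair is the product of the laws, so by
Tonelli the second variable can be integrated first. *)
Lemma independent_integral_le (f : T1 * T2 -> \bar R) (g : T1 -> \bar R) :
  measurable_fun setT f -> (forall x, 0 <= f x)%E -> measurable_fun setT g ->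
  (forall x, \int[P]_w f (x, V w) <= g x)%E ->
  (\int[P]_w f (U w, V w) <= \int[P]_w g (U w))%E.
Proof.
move=> mf f0 mg fg.
have g0 x : (0 <= g x)%E.
  by apply: le_trans (fg x); apply: integral_ge0 => w _.
have mUV : measurable_fun setT (fun w => (U w, V w)).
  by apply: measurable_fun_pair; exact: measurable_funPT.
pose mixin := isMeasurableFun.Build _ _ _ _ (fun w => (U w, V w)) mUV.
pose UVm : {RV P >-> (T1 * T2)%type} := HB.pack (fun w => (U w, V w)) mixin.
rewrite -(ge0_integral_distribution UVm)//.
rewrite -(@eq_measure_integral _ _ _ _ (distribution P UVm)
  (distribution P U \x distribution P V)%E); last first.
  by move=> B mB _; apply: product_measure_unique => // B1 B2 mB1 mB2; exact: UV.
rewrite fubini_tonelli1// -[leRHS](ge0_integral_distribution U)//.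
apply: ge0_le_integral => //.
- by move=> x _; exact: integral_ge0.
- exact: measurable_fun_fubini_tonelli_F.
- move=> x _; rewrite /fubini_F ge0_integral_distribution//; first exact: fg.
  exact: measurable_fun_pair2.
Qed.

End independent_pair.

Section past.
Context d (T : measurableType d) (R : realType) (P : probability T R) (n : nat).
Variable X : 'I_n -> {RV P >-> R}.

(** A pi-system that generates the sigma-algebra of the first [k] variables. *)
Definition past_cylinders (k : nat) : set (set T) :=
  [set D | exists2 B : 'I_n -> set R, forall i, measurable (B i) &
    D = \bigcap_(i in [set i : 'I_n | (i < k)%N]) X i @^-1` B i].

Lemma past_cylinders_measurable k : past_cylinders k `<=` measurable.
Proof.
move=> _ [B mB ->]; apply: fin_bigcap_measurable => // i _.
by rewrite -[X in measurable X]setTI; exact: measurable_funPT.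
Qed.

Lemma past_cylinders_setI k : setI_closed (past_cylinders k).
Proof.
move=> _ _ [B mB ->] [C mC ->]; exists (fun i => B i `&` C i).
  by move=> i; exact: measurableI.
by rewrite -bigcapI.
Qed.

Lemma past_cylindersT k : past_cylinders k setT.
Proof.
exists (fun=> setT) => //; apply/seteqP; split => // w _ i _ //.
Qed.

Lemma preimage_past_cylinders (k : nat) (i : 'I_n) (B : set R) :
  (i < k)%N -> measurable B -> past_cylinders k (X i @^-1` B).
Proof.
move=> ik mB; exists (fun j => if j == i then B else setT).
  by move=> j; case: ifP.
apply/seteqP; split=> w /= h; last by have := h i ik; rewrite /= eqxx.
by move=> j jk /=; case: eqP => [->|].
Qed.

Hypothesis Xind : mutual_independence X.

Lemma past_cylinders_independent (k : 'I_n) (D : set T) (C : set R) :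
  past_cylinders k D -> measurable C ->
  P (D `&` X k @^-1` C) = (P D * P (X k @^-1` C))%E.
Proof.
move=> [B mB ->] mC.
pose J := [set i : 'I_n | (i < k)%N]%SET.
have kJ : k \notin J by rewrite inE ltnn.
have JE : [set` J] = [set i : 'I_n | (i < k)%N].
  by apply/seteqP; split => i /=; rewrite inE.
have := Xind (J := k |: J) (B := fun i => if i == k then C else B i).
move=> /(_ _)/wrap[|H]; first by move=> i _; case: ifP.
have := Xind (J := J) (B := B) => /(_ (fun i _ => mB i)) H'.
rewrite big_setU1//= eqxx in H.
rewrite (eq_bigr (fun i => P (X i @^-1` B i))) in H; last first.
  by move=> i; case: eqP => // ->; rewrite (negbTE kJ).
rewrite -H' JE in H; rewrite muleC -[RHS]H; congr (P _).
apply/seteqP; split => w /=.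
  by move=> [hJ hk] i; rewrite /= !inE; case: eqP => [->//|_/=]; exact: hJ.
move=> h; split => [i ik|].
  have := h i; rewrite /= !inE ik orbT; case: eqP => [ik'|_]; last exact.
  by move: ik; rewrite /= ik' ltnn.
by have := h k; rewrite /= !inE eqxx; exact.
Qed.

(** Both sides are finite measures in [D] that agree on the pi-system of
cylinders. *)
Lemma past_independent (k : 'I_n) (D : set T) (C : set R) :
  <<s past_cylinders k >> D -> measurable C ->
  P (D `&` X k @^-1` C) = (P D * P (X k @^-1` C))%E.
Proof.
move=> GD mC.
have mXC : measurable (X k @^-1` C).
  by rewrite -[X in measurable X]setTI; exact: measurable_funPT.
have pfin : P (X k @^-1` C) \is a fin_num by exact: fin_num_measure.
have p0 : 0 <= fine (P (X k @^-1` C)) by exact: fine_ge0.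
pose p := NngNum p0.
have mscaleE E : mscale p P E = (P E * P (X k @^-1` C))%E.
  by rewrite /mscale/= fineK// muleC.
rewrite -mscaleE.
apply: (@g_sigma_algebra_measure_unique _ _ _ (past_cylinders k)
  (@past_cylinders_measurable k) (fun=> setT) _ _ (mrestr P mXC) (mscale p P)) => //.
- by move=> _; exact: past_cylindersT.
- by apply/seteqP; split => // w _; exists 0%N.
- exact: past_cylinders_setI.
- by move=> E GE; rewrite [RHS]mscaleE; exact: past_cylinders_independent.
- move=> _; rewrite /mrestr; apply: (@le_lt_trans _ _ 1%E); last exact: ltry.
  by apply: probability_le1; exact: measurableI.
Qed.

End past.

(** * Integration of one-step bounds *)

Section one_step.
Context d (T : measurableType d) (R : realType) (P : probability T R).
Variables (A s : R) (X : {RV P >-> R}).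
Hypothesis EX : ('E_P[X] = 0)%E.
Hypothesis EX4 : ('E_P[fun w => (X w ^+ 4)%R] <= A%:E)%E.
Hypothesis EXp :
  (s%:E <= 'E_P[fun w => (X w * \1_[set x : R | (0 < x)%R] (X w))%R])%E.

Let mX : measurable_fun setT X. Proof. exact: measurable_funPT. Qed.

Let mX4 : measurable_fun setT (fun w => X w ^+ 4).
Proof. exact: measurable_funX. Qed.

Let X4_ge0 w : 0 <= X w ^+ 4. Proof. exact: exprn_even_ge0. Qed.

Lemma integrable_pow4 : P.-integrable setT (fun w => (X w ^+ 4)%:E).
Proof.
apply/integrableP; split; first exact/measurable_EFinP.
apply: le_lt_trans (ltry A); have := EX4; rewrite unlock.
rewrite [in X in _ -> X](eq_integral (fun w => (X w ^+ 4)%:E))// => w _.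
by rewrite /= ger0_norm.
Qed.

Lemma integrable_of_pow4 : P.-integrable setT (fun w => (X w)%:E).
Proof.
have h : P.-integrable setT (fun w => (1 + X w ^+ 4)%:E).
  rewrite (_ : (fun _ => _) = (cst 1%E \+ (fun w => (X w ^+ 4)%:E))%E) //.
  apply: integrableD => //; first exact: finite_measure_integrable_cst.
  exact: integrable_pow4.
apply: le_integrable h => //; first exact/measurable_EFinP.
move=> w _ /=; rewrite lee_fin [leRHS]ger0_norm; first exact: norm_le_1Dpow4.
by rewrite addr_ge0.
Qed.

(** The positive part is moved to the side of [g], so that only nonnegative
functions appear there and [g (X w)] need not be known to be integrable. *)
Lemma integral_le_moment_bound (g : R -> R) (b : R) :
  measurable_fun setT g -> (forall x, 0 <= g x) -> moment_bound A s g b ->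
  (\int[P]_w (g (X w))%:E <= b%:E)%E.
Proof.
move=> mg g0 [a1 [a4 [a5 [a40 a50 hb]]]].
have iX := integrable_of_pow4; have iX4 := integrable_pow4.
pose c := b - a4 * A + a5 * s.
have mp : measurable_fun setT (fun w => Num.max (X w) 0).
  exact: measurable_maxr.
have mgX : measurable_fun setT (fun w => g (X w)) by exact: measurableT_comp.
have p0 w : 0 <= Num.max (X w) 0 by rewrite le_max lexx orbT.
have EXp' : (s%:E <= \int[P]_w (Num.max (X w) 0)%:E)%E.
  have := EXp; rewrite unlock => /le_trans; apply; rewrite le_eqVlt; apply/orP; left.
  apply/eqP; apply: eq_integral => w _; congr (_%:E).
  rewrite indicE; case: (ltP 0 (X w)) => h.
    by rewrite mem_set//= mulr1.
  by rewrite memNset ?mulr0//=; apply/negP; rewrite -leNgt.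
have EX4' : (\int[P]_w (X w ^+ 4)%:E <= A%:E)%E by have := EX4; rewrite unlock.
have EX' : (\int[P]_w (X w)%:E = 0)%E by have := EX; rewrite unlock.
have : (\int[P]_w ((g (X w))%:E + (a5 * Num.max (X w) 0)%:E) <=
        \int[P]_w (c%:E + ((a1 * X w)%:E + (a4 * X w ^+ 4)%:E)))%E.
  apply: ge0_le_integral => //=.
  - by move=> w _; rewrite lee_fin addr_ge0// mulr_ge0.
  - apply: emeasurable_funD; apply/measurable_EFinP => //.
    exact: measurable_funM.
  - apply: emeasurable_funD; first by [].
    by apply: emeasurable_funD; apply/measurable_EFinP; exact: measurable_funM.
  - move=> w _; rewrite lee_fin; have := hb (X w); rewrite /c; lra.
rewrite ge0_integralD//=; last 4 first.
- by move=> w _; rewrite lee_fin.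
- exact/measurable_EFinP.
- by move=> w _; rewrite lee_fin mulr_ge0.
- by apply/measurable_EFinP; exact: measurable_funM.
have iaX : P.-integrable setT (fun w => (a1 * X w)%:E).
  by have := integrableZl measurableT a1 iX; apply: eq_integrable.
have iaX4 : P.-integrable setT (fun w => (a4 * X w ^+ 4)%:E).
  by have := integrableZl measurableT a4 iX4; apply: eq_integrable.
rewrite integralD//=; last 2 first.
- exact: finite_measure_integrable_cst.
- exact: integrableD.
rewrite integral_cst//= probability_setT mule1 integralD//=.
under [X in (_ + X <= _)%E]eq_integral do rewrite EFinM.
rewrite ge0_integralZl//=; last first.
- by move=> w _; rewrite lee_fin.
- exact/measurable_EFinP.
under [X in (_ <= _ + (X + _))%E]eq_integral do rewrite EFinM.
under [X in (_ <= _ + (_ + X))%E]eq_integral do rewrite EFinM.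
rewrite !integralZl//= EX' mule0 add0e.
have f4 := integrable_fin_num measurableT iX4.
have := EX4'; rewrite -(fineK f4) lee_fin; set m4 := fine _ => hm4.
move=> h.
have : (\int[P]_w (g (X w))%:E + (a5 * s)%:E <= (c + a4 * A)%:E)%E.
  apply: (le_trans (y := (c + a4 * m4)%:E)); last first.
    by rewrite lee_fin lerD2l ler_wpM2l.
  apply: le_trans h; rewrite leeD2l// EFinM lee_wpmul2l// lee_fin.
rewrite -leeBrDr// -EFinB => /le_trans; apply.
by rewrite lee_fin /c; lra.
Qed.

End one_step.

(** * The walk stopped when it becomes negative *)

Section stopped_walk.
Context d (T : measurableType d) (R : realType) (P : probability T R) (m : nat).
Local Notation n := m.+1.
Variables (X : 'I_n -> {RV P >-> R}) (u : R).

(** The walk is frozen at its first negative value: the event that it has stayed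
nonnegative is then read off from its current position. *)
Fixpoint stopped (k : nat) (w : T) : R :=
  if k is k'.+1 then
    let x := stopped k' w in if 0 <= x then x + X (inord k') w else x
  else u.

Lemma walkS (k : nat) w : (k < n)%N ->
  walk X u k.+1 w = walk X u k w + X (inord k) w.
Proof.
move=> kn; have kE : nat_of_ord (inord k : 'I_n) = k by rewrite inordK.
rewrite /walk (bigD1 (inord k))/= ?kE// -addrA; congr (_ + _).
rewrite addrC; congr (_ + _); apply: eq_bigl => i.
rewrite ltnS ltn_neqAle andbC; congr (_ && _).
by rewrite -(inj_eq val_inj)/= kE.
Qed.

Lemma walk_measurable (k : nat) : (k <= n)%N -> measurable_fun setT (walk X u k).
Proof.
elim: k => [_|k IH kn].
  rewrite (_ : walk _ _ _ = cst u)//; apply/funext => w.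
  by rewrite /walk big_pred0 ?addr0// => i; rewrite ltn0.
rewrite (_ : walk _ _ _ = walk X u k \+ X (inord k)).
  by apply: measurable_funD; [exact: IH (ltnW kn)|exact: measurable_funPT].
by apply/funext => w; rewrite walkS.
Qed.

Lemma survival_measurable : measurable [set w | (n%:R%:E < tau X u w)%E].
Proof.
rewrite tau_gtE (_ : [set w | _] = \bigcap_(k in [set k | (1 <= k <= n)%N])
  [set w | 0 <= walk X u k w]); last by [].
apply: bigcap_measurableType => k /andP[_ kn].
rewrite -[X in measurable X]setTI.
by apply: measurable_fun_le => //; exact: walk_measurable.
Qed.

Lemma stopped_walk (k : nat) w : (k <= n)%N -> 0 <= u ->
  (forall j, (1 <= j <= n)%N -> 0 <= walk X u j w) ->
  stopped k w = walk X u k w.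
Proof.
move=> + u0 h; elim: k => [_|k IH kn] /=.
  by rewrite /walk big_pred0 ?addr0// => i; rewrite ltn0.
rewrite IH ?(ltnW kn)// walkS//.
case: k kn {IH} => [|k] kn; last first.
  have -> // : 0 <= walk X u k.+1 w by apply: h; rewrite /= ltnW.
by rewrite /walk big_pred0 ?addr0 ?u0// => i; rewrite ltn0.
Qed.

Lemma stopped_past_measurable (k j : nat) : (j <= k <= n)%N ->
  measurable_fun (setT : set (g_sigma_algebraType (past_cylinders X k)))
    (stopped j).
Proof.
elim: j => [_|j IH /andP[jk kn]] /=; first exact: measurable_cst.
have mj : measurable_fun (setT : set (g_sigma_algebraType (past_cylinders X k)))
  (stopped j) by apply: IH; rewrite (ltnW jk).
apply: measurable_fun_ifT => //; first exact: measurable_fun_ler.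
apply: measurable_funD => //.
move=> _ B mB; rewrite setTI; apply: sub_sigma_algebra.
by apply: preimage_past_cylinders => //; rewrite inordK// (leq_trans jk).
Qed.

Lemma stopped_measurable (k : nat) : (k <= n)%N -> measurable_fun setT (stopped k).
Proof.
move=> kn _ B mB.
have kk : (k <= k <= n)%N by rewrite leqnn.
have := stopped_past_measurable kk measurableT mB.
by apply: smallest_sub; [exact: sigma_algebra_measurable|
  exact: past_cylinders_measurable].
Qed.

Lemma measurable_step (h : R -> R) : measurable_fun setT h ->
  measurable_fun setT
    (fun p : R * R => (h (if 0 <= p.1 then p.1 + p.2 else p.1))%:E).
Proof.
move=> mh; apply/measurable_EFinP; apply: measurableT_comp => //.
apply: measurable_fun_ifT => //; first by apply: measurable_fun_ler.
exact: measurable_funD.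
Qed.

Hypothesis Xind : mutual_independence X.

Lemma stopped_step_le (h g : R -> R) (k : nat) : (k < n)%N ->
  measurable_fun setT h -> (forall x, 0 <= h x) -> measurable_fun setT g ->
  (forall x, 0 <= x -> (\int[P]_w (h (x + X (inord k) w)%R)%:E <= (g x)%:E)%E) ->
  (forall x, x < 0 -> h x <= g x) ->
  (\int[P]_w (h (stopped k.+1 w))%:E <= \int[P]_w (g (stopped k w))%:E)%E.
Proof.
move=> kn mh h0 mg hg hneg.
have mU := stopped_measurable (ltnW kn).
pose mixin := isMeasurableFun.Build _ _ _ _ (stopped k) mU.
pose U : {RV P >-> R} := HB.pack (stopped k) mixin.
apply: (@independent_integral_le _ _ _ _ _ _ _ P U (X (inord k)) _
  (fun p => (h (if 0 <= p.1 then p.1 + p.2 else p.1))%:E) (fun x => (g x)%:E)).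
- move=> B C mB mC; apply: past_independent => //.
  rewrite inordK//.
  have kk : (k <= k <= n)%N by rewrite leqnn ltnW.
  by have := stopped_past_measurable kk measurableT mB; rewrite setTI.
- exact: measurable_step.
- by move=> x; rewrite lee_fin.
- exact/measurable_EFinP.
- move=> x /=; case: (leP 0 x) => hx; first exact: hg.
  by rewrite integral_cst//= probability_setT mule1 lee_fin hneg.
Qed.

(** The mean of [h k] at the stopped walk is nonincreasing in [k]; it starts at
[h 0 u], and at time [n] it is at least the survival probability. *)
Lemma survival_le_supermartingale (h : nat -> R -> R) : 0 <= u ->
  (forall k, measurable_fun setT (h k)) -> (forall k x, 0 <= h k x) ->
  (forall k x, (k < n)%N -> 0 <= x ->
    (\int[P]_w (h k.+1 (x + X (inord k) w)%R)%:E <= (h k x)%:E)%E) ->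
  (forall k x, x < 0 -> h k.+1 x <= h k x) ->
  (forall x, 0 <= x -> 1 <= h n x) ->
  (P [set w | (n%:R%:E < tau X u w)%E] <= (h 0%N u)%:E)%E.
Proof.
move=> u0 mh h0 hstep hneg hn.
have hE k : (k <= n)%N -> (\int[P]_w (h k (stopped k w))%:E <= (h 0%N u)%:E)%E.
  elim: k => [_|k IH kn].
    by rewrite /= integral_cst//= probability_setT mule1.
  apply: le_trans (IH (ltnW kn)); apply: stopped_step_le => //.
  - by move=> x x0; exact: hstep.
  - by move=> x x0; exact: hneg.
apply: le_trans (hE n (leqnn _)).
have mSn := stopped_measurable (leqnn n).
have mS : measurable [set w | 0 <= stopped n w].
  by rewrite -[X in measurable X]setTI; apply: measurable_fun_le.
apply: (@le_trans _ _ (P [set w | 0 <= stopped n w])).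
  apply: le_measure; rewrite ?inE//.
    exact: survival_measurable.
  rewrite tau_gtE => w hw.
  rewrite /= -/(stopped n w) (stopped_walk (leqnn n) u0 hw).
  by apply: hw; rewrite leqnn.
rewrite -[X in P X]setIT -(integral_indic P measurableT mS).
apply: ge0_le_integral => //=.
- by apply/measurable_EFinP; exact: measurable_indic.
- by apply/measurable_EFinP; apply: measurableT_comp.
- move=> w _; rewrite lee_fin indicE; case: (boolP (w \in _)) => //= hw.
  by apply: hn; move: hw; rewrite inE.
Qed.

End stopped_walk.

(** * The supermartingale and the conclusion *)

Section truncated.
Variables (R : realType) (n : nat) (F : R -> R).

(** The drift - 1 / n of [F] compensates the increase of k / n wherever
F x + k / n < 1; elsewhere the truncation at 1 gives the supermartingale
inequality for free. *)
Definition truncated (k : nat) : R -> R :=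
  killed (fun x => Num.min 1 (F x + k%:R / n%:R)).

Lemma measurable_truncated k : measurable_fun setT F ->
  measurable_fun setT (truncated k).
Proof.
move=> mF; apply: measurable_fun_ifT => //.
  exact: measurable_fun_ler.
by apply: measurable_minr => //; exact: measurable_funD.
Qed.

Lemma truncated_ge0 k x : (forall x, 0 <= x -> 0 <= F x) -> 0 <= truncated k x.
Proof.
move=> F0; rewrite /truncated /killed; case: (leP 0 x) => // x0.
by rewrite le_min ler01/= addr_ge0 ?F0// divr_ge0.
Qed.

Lemma truncated_le1 k x : truncated k x <= 1.
Proof.
by rewrite /truncated /killed; case: (leP 0 x) => // x0; rewrite ge_min lexx.
Qed.

Lemma truncated_le_killed k x : truncated k x <= killed F x + k%:R / n%:R.
Proof.
rewrite /truncated /killed; case: (leP 0 x) => // x0.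
by rewrite ge_min lexx orbT.
Qed.

End truncated.

Theorem lemma3p8 (R : realType) (A s : R) (hA : 0 < A) (hs : 0 < s) :
  exists2 c : R, 0 < c &
    forall (d : measure_display) (T : measurableType d) (P : probability T R)
           (n : nat) (X : 'I_n -> {RV P >-> R}) (u : R),
      (1 <= n)%N ->
      mutual_independence X ->
      (forall i : 'I_n, ('E_P[X i] = 0)%E) ->
      (forall i : 'I_n, ('E_P[fun w => (X i w ^+ 4)%R] <= A%:E)%E) ->
      (forall i : 'I_n,
         (s%:E <= 'E_P[fun w => (X i w * \1_[set x : R | 0 < x] (X i w))%R])%E) ->
      0 <= u ->
      (P [set w | n%:R%:E < tau X u w] <= (c * (u + 1) / Num.sqrt n%:R)%:E)%E.
Proof.
have [C C0 HC] := exists_lyapunov hA hs.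
pose c0 := 64 * (32 * A) / s ^+ 4.
have s4 : 0 < s ^+ 4 by exact: exprn_gt0.
have c00 : 0 <= c0 by rewrite divr_ge0 ?(ltW s4) ?mulr_ge0 ?(ltW hA).
have Cs0 : 0 < 24 * C / s by rewrite divr_gt0// mulr_gt0.
exists (c0 + 1 + 24 * C / s); first by lra.
move=> d T P [//|m] X u _ Xind EX EX4 EXp u0.
set n := m.+1; set c := c0 + 1 + _.
have n1 : 1 <= n%:R :> R by rewrite ler1n.
have n0 : 0 < n%:R :> R by rewrite ltr0n.
pose q := Num.sqrt (n%:R : R).
have q1 : 1 <= q by rewrite -sqrtr1 ler_sqrt.
have q0 : 0 < q by exact: lt_le_trans q1.
have qE : q ^+ 2 = n%:R by rewrite sqr_sqrtr// ltW.
rewrite -/q.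
(* For n below c0 the claimed bound is at least 1; for larger n the scale L is large
   enough for the drift estimate. *)
have [small|large] := ltP (n%:R : R) c0.
  apply: (@le_trans _ _ 1%E).
    by apply: probability_le1; exact: survival_measurable.
  rewrite lee_fin ler_pdivlMr// mul1r.
  have qc : q <= c by rewrite /c; nra.
  by apply: (le_trans qc); rewrite ler_peMr ?lerDr//; lra.
(* With this L the drift 3 / L * (s ^+ 2 / (128 * L)) is 3 / (2 n). *)
pose L := s * q / 8.
have L0 : 0 < L by rewrite divr_gt0// mulr_gt0.
have hL : 32 * A / s ^+ 2 <= L ^+ 2.
  rewrite ler_pdivrMr ?exprn_gt0//.
  rewrite (_ : L ^+ 2 * s ^+ 2 = n%:R * s ^+ 4 / 64); last by rewrite -qE /L; field.
  by move: large; rewrite /c0 ler_pdivrMr//; lra.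
have [F0 [mF0 [F0b F0L F0m]]] := HC L L0 hL.
pose F x := 3 / L * F0 x.
have L3 : 0 <= 3 / L by rewrite divr_ge0// ltW.
have mF : measurable_fun setT F by exact: measurable_funM.
have F_ge0 x : 0 <= x -> 0 <= F x.
  by move=> x0; rewrite mulr_ge0//; have /andP[] := F0b x x0.
pose h := truncated n F.
apply: (@le_trans _ _ (h 0%N u)%:E); last first.
  rewrite lee_fin; apply: (le_trans (truncated_le_killed _ _ _ _)).
  rewrite mul0r addr0 /killed u0 /F.
  have /andP[_ hu] := F0b u u0.
  apply: (le_trans (ler_wpM2l L3 hu)).
  rewrite (_ : 3 / L * (C * (u + 1)) = 24 * C / s * (u + 1) / q); last first.
    by rewrite /L; field; rewrite !gt_eqF.
  rewrite ler_pM2r ?invr_gt0// ler_wpM2r ?addr_ge0//.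
  by rewrite /c lerDr; lra.
apply: survival_le_supermartingale => //.
- by move=> k; exact: measurable_truncated.
- by move=> k x; exact: truncated_ge0.
- move=> k x kn x0.
  rewrite [in leRHS]/h /truncated /killed x0.
  have [big|small] := leP 1 (F x + k%:R / n%:R).
    apply: (@le_trans _ _ (\int[P]_w (cst 1%E w)))%E; last first.
      by rewrite integral_cst//= probability_setT mule1.
    apply: ge0_le_integral => //.
    + by move=> w _; rewrite lee_fin truncated_ge0.
    + apply/measurable_EFinP; apply: measurableT_comp.
        exact: measurable_truncated.
      by apply: measurable_funD => //; exact: measurable_funPT.
    + by move=> w _; rewrite lee_fin truncated_le1.
  have xL : x <= L.
    rewrite leNgt; apply/negP => /ltW /F0L hx.
    have : 1 <= F x.
      apply: le_trans (ler_wpM2l L3 hx).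
      by rewrite (_ : 3 / L * (L / 3) = 1)//; field; rewrite gt_eqF.
    have : 0 <= k%:R / n%:R :> R by rewrite divr_ge0.
    lra.
  have hx : 0 <= x <= L by rewrite x0.
  have hb := moment_boundD (moment_boundZ L3 (F0m x hx))
     (moment_bound_cst A s (k.+1%:R / n%:R)).
  apply: (integral_le_moment_bound (EX (inord k)) (EX4 (inord k))
    (EXp (inord k)) (g := fun z => h k.+1 (x + z))).
  + apply: measurableT_comp; first exact: measurable_truncated.
    exact: measurable_funD.
  + by move=> z; exact: truncated_ge0.
  apply: moment_bound_le hb => [z|].
    apply: (le_trans (truncated_le_killed _ _ _ _)).
    by rewrite lerD2r /killed; case: (leP 0 (x + z)) => //; rewrite mulr0.
  rewrite (_ : 3 / L * _ + _ = F x + k%:R / n%:R - (2 * n%:R)^-1).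
    by rewrite gerBl invr_ge0 mulr_ge0// ltW.
  by rewrite /F /L -qE -natr1; field; rewrite !gt_eqF.
- move=> k x x0; rewrite /h /truncated /killed.
  by rewrite (leNgt 0 x) x0.
- move=> x x0; rewrite /h /truncated /killed x0 le_min lexx/=.
  by rewrite divff ?gt_eqF// lerDr F_ge0.
Qed.
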